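(* The construction is dense for degree-$3$ curves; that is, there is a nonempty Zariski-open set $U$ of degree-$3$ plane curves (a nonempty Zariski-open subset $U\subset \mathbb{P}(S_3)\cong\mathbb{P}^9$) such that every curve $X\in U$ is constructible.
   Context: Let $S=\mathbb{C}[x,y,z]=\bigoplus_{d\ge 0}S_d$. Degree-$d$ curves in the complex projective plane $\mathbb{P}^2$ are identified with points of the projective space $\mathbb{P}(S_d)$ (nonzero forms of degree $d$ up to nonzero scalar), equipped with the Zariski topology. A curve $X$ of degree $d$ is called constructible if there exist $d+1$ red lines $\ell_1,\dots,\ell_{d+1}$ and $d+1$ blue lines $L_1,\dots,L_{d+1}$ in $\mathbb{P}^2$ such that the $d+1$ points $\ell_i\cap L_i$ ($1\le i\le d+1$) are collinear and the other $d(d+1)$ points $\ell_i\cap L_j$ ($i\ne j$) lie on $X$; here the $(d+1)^2$ points $\ell_i\cap L_j$ are understood to be pairwise distinct. The construction is said to be dense for degree-$d$ curves if there is a nonempty Zariski-open subset $U\subset\mathbb{P}(S_d)$ such that each $X\in U$ is constructible. *)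

(* Defs.v *)
From mathcomp Require Import all_boot all_order all_algebra.
From mathcomp Require Import reals complex.
From mathcomp Require Import mpoly.

Set Implicit Arguments.
Unset Strict Implicit.
Unset Printing Implicit Defensive.

Import GRing.Theory.
Local Open Scope ring_scope.

Section ProjectiveSpace.
Variables (K : fieldType) (V : vectType K).

(* P(V): a nonzero vector up to nonzero scalar is the line that it spans. *)
Definition projective : Type := {x : {vspace V} | \dim x == 1%N}.

(* F is a polynomial in the coordinates of V in the basis vbasis {:V}.  For
   homogeneous F, vanishing on the whole line x amounts to vanishing at one
   nonzero vector of x. *)
Definition form_vanishes (F : {mpoly K[\dim {:V}]}) (x : projective) : Prop :=
  forall v : V, v \in val x -> F.@[fun i => coord (vbasis {:V}) i v] = 0.

(* Another basis of V would give the same topology, as a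
   linear change of variables preserves homogeneous polynomials. *)
Definition zariski_closed (Z : projective -> Prop) : Prop :=
  exists I : {mpoly K[\dim {:V}]} -> Prop,
    (forall F, I F -> exists k : nat, F \is k.-homog) /\
    (forall x, Z x <-> forall F, I F -> form_vanishes F x).

Definition zariski_open (U : projective -> Prop) : Prop :=
  zariski_closed (fun x => ~ U x).

End ProjectiveSpace.

Section PlaneCurves.
Variable K : fieldType.

Definition point : Type := projective 'rV[K]_3.

(* The points of P^2 on a line are the 1-dimensional subspaces of a plane
   of K^3. *)
Definition line : Type := {l : {vspace 'rV[K]_3} | \dim l == 2%N}.

Definition on_line (p : point) (l : line) : Prop := (val p <= val l)%VS.

(* dhomog 3 K d is the space S_d of forms of degree d in three variables,
   including 0. *)
Definition curve (d : nat) : Type := projective (dhomog 3 K d).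

Definition on_curve (d : nat) (p : point) (X : curve d) : Prop :=
  forall (f : dhomog 3 K d) (v : 'rV[K]_3),
    f \in val X -> v \in val p -> (f : {mpoly K[3]}).@[fun i => v 0 i] = 0.

(* P i j is the point where the red line l i meets the blue line L j; as the
   intersection of the two planes of K^3 has dimension 1, l i and L j are
   distinct lines. *)
Definition constructible (d : nat) (X : curve d) : Prop :=
  exists (l L : 'I_d.+1 -> line) (P : 'I_d.+1 -> 'I_d.+1 -> point),
    [/\ forall i j, (val (l i) :&: val (L j))%VS = val (P i j),
        forall i j i' j', P i j = P i' j' -> i = i' /\ j = j',
        exists m : line, forall i, on_line (P i i) m
      & forall i j, i != j -> on_curve (P i j) X].

Definition construction_dense (d : nat) : Prop :=
  exists U : curve d -> Prop,
    [/\ zariski_open U, exists X, U X & forall X, U X -> constructible X].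

End PlaneCurves.

(* Main.v *)
Require Import Defs.
From mathcomp Require Import all_boot all_order all_algebra.
From mathcomp Require Import reals complex.
From mathcomp Require Import mpoly.
From mathcomp Require Import ring zify.

Set Implicit Arguments.
Unset Strict Implicit.
Unset Printing Implicit Defensive.

Import GRing.Theory.
Local Open Scope ring_scope.

(** The theorem holds because a general cubic F can be written explicitly as
    F = x y d + e a b c with d a linear form, e a scalar and
    a = a1 x + a2 y + z, b = b1 x + b2 y + z, c = c1 x + c2 y + z: the restrictions
    of F to the lines x = 0 and y = 0 split over an algebraically closed field,
    which gives e, a, b, c, and then F - e a b c is divisible by x y.  This
    parametrizes the cubics with nonzero coefficient at z^3 by the ten
    numbers e, a1, a2, b1, b2, c1, c2, d1, d2, d3 (cubic_coef_onto).

    The red lines are d = 0 and the three lines r0, r1, r2 that join a point of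
    x = 0 with a point of y = 0 in the hexagon inscribed in these two lines by
    a, b, c.  Both r0 r1 r2 and a b c restrict to the same forms on x = 0 and on
    y = 0, so r0 r1 r2 - a b c = x y m with m linear (the Pappus line).  Hence
      F m = d (r0 r1 r2 - a b c) + e a b c m = r0 r1 r2 d - a b c (d - e m).
    The blue lines are a, b, c and d - e m.  At the intersection of a red and a
    blue line F m vanishes; for paired lines m vanishes, and for the others m
    does not vanish in general, so that F does (cubic_identity, pappus_diag,
    constructible_of_identity).

    What is left is to see that a general cubic comes from nondegenerate
    parameters only.  Nondegeneracy is the nonvanishing of a polynomial G in the
    ten parameters, and G is not the zero polynomial, by one numerical
    example.  The parametrization is a polynomial map between affine spaces of
    the same dimension 10, so it maps the hypersurface G = 0 into a
    hypersurface N = 0 (hypersurface_image), by the algebraic dependence of 11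
    polynomials in 10 variables.  The open set consists of
    the cubics with N nonzero and with nonzero coefficient at z^3.  Although N need
    not be homogeneous, it defines an open set of the projective space
    through its homogeneous components (zariski_open_nonvanishing). *)

(** * Values and images of polynomials in several variables *)

Lemma widen_lift_max n (i : 'I_n) : widen_ord (leqnSn n) i = lift ord_max i.
Proof. by apply: val_inj; rewrite /= /bump leqNgt ltn_ord. Qed.

(** A nonzero univariate polynomial over an algebraically closed field has a
    nonroot; several variables reduce to this by seeing the last one as the
    variable of a polynomial with coefficients in the others. *)
Lemma exists_meval_neq0 (K : closedFieldType) n (p : {mpoly K[n]}) :
  p != 0 -> exists v : 'I_n -> K, p.@[v] != 0.
Proof.
elim: n p => [|n IHn] p p_neq0.
  exists (fun=> 0); apply: contra_neq p_neq0 => p_v0.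
  have sz_p : (msize p <= 1)%N.
    rewrite msizeE; apply/bigmax_leqP_seq => m _ _.
    by rewrite mdegE big_ord0.
  by have := msize1_polyC sz_p => pE; move: p_v0; rewrite pE mevalC => ->.
pose m0 := mlead p; pose k0 := m0 ord_max.
pose low (m : 'X_{1..n.+1}) := [multinom m (widen_ord (leqnSn n) i) | i < n].
have low_inj m : (low m == low m0) && (m ord_max == k0) = (m == m0).
  apply/andP/eqP => [[/eqP/mnmP low_eq /eqP max_eq]|->]; last by [].
  apply/mnmP => i; case: (unliftP ord_max i) => [j ->|->]; last by [].
  by have := low_eq j; rewrite !mnmE widen_lift_max.
have coef_neq0 : (muni p)`_k0 != 0.
  apply/eqP => /(congr1 (mcoeff (low m0))); rewrite mcoeff0 muniE coef_sum.
  rewrite raddf_sum /= (bigD1_seq m0) ?msupp_uniq ?mlead_supp //=.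
  rewrite big1 => [|m m_neq].
    rewrite coefZ coefXn eqxx mulr1 mcoeffZ mcoeffX eqxx mulr1 addr0.
    by apply/eqP; rewrite -mcoeff_msupp mlead_supp.
  move: m_neq; rewrite -low_inj coefZ coefXn (eq_sym k0).
  case: (m ord_max == k0); last by rewrite mulr0 mcoeff0.
  by rewrite andbT mulr1 mcoeffZ mcoeffX => /negbTE->; rewrite mulr0.
have [u u_neq0] := IHn _ coef_neq0.
have : map_poly (meval u) (muni p) != 0.
  by apply/eqP => /polyP/(_ k0); rewrite coef_map coef0 => /eqP; apply/negP.
move=> /closed_nonrootP[t]; rewrite /root => t_neq0.
exists (fun i => oapp u t (unlift ord_max i)).
apply: contra_neq t_neq0 => <-.
rewrite muniE rmorph_sum horner_sum mevalE; apply: eq_bigr => m _.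
rewrite /= map_polyZ map_polyXn hornerZ hornerXn /= mevalZ mevalX -mulrA.
rewrite big_ord_recr /= unlift_none; congr (_ * (_ * _)).
apply: eq_bigr => i _; rewrite mnmE.
by rewrite widen_lift_max liftK.
Qed.

Section PolynomialMaps.
Variable K : fieldType.

(** More vectors than coordinates: the #|A| vectors c a of K^B are linearly
    dependent. *)
Lemma nontrivial_relation (A B : finType) (c : A -> B -> K) :
  (#|B| < #|A|)%N ->
  exists2 h : A -> K, exists a, h a != 0 & forall b, \sum_a h a * c a b = 0.
Proof.
move=> ltBA.
pose C := \matrix_(i < #|A|, j < #|B|) c (enum_val i) (enum_val j).
have /rowV0Pn[u /sub_kermxP uC u_neq0] : kermx C != 0.
  rewrite -mxrank_eq0 mxrank_ker -lt0n subn_gt0.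
  by apply: leq_ltn_trans ltBA; apply: rank_leq_col.
exists (fun a => u 0 (enum_rank a)).
  have /existsP[i ui] : [exists i, u 0 i != 0].
    apply: contraNT u_neq0 => /existsPn u0; apply/eqP/rowP => i.
    by rewrite mxE; apply/eqP; rewrite -[_ == _]negbK u0.
  by exists (enum_val i); rewrite enum_valK.
move=> b; transitivity ((u *m C) 0 (enum_rank b)); last by rewrite uC mxE.
rewrite mxE (reindex _ (onW_bij _ (@enum_val_bij A))) /=.
by apply: eq_bigr => i _; rewrite mxE enum_valK enum_rankK.
Qed.

Lemma msizeM_le_add n (p q : {mpoly K[n]}) (a b : nat) :
  (msize p <= a.+1 -> msize q <= b.+1 -> msize (p * q) <= (a + b).+1)%N.
Proof.
move=> p_le q_le.
have [->|p_neq0] := eqVneq p 0; first by rewrite mul0r msize0.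
have [->|q_neq0] := eqVneq q 0; first by rewrite mulr0 msize0.
rewrite msizeM //; move: (msize p) (msize q) p_le q_le => u v; lia.
Qed.

Lemma msizeX_le_mul n (p : {mpoly K[n]}) (a k : nat) :
  (msize p <= a.+1 -> msize (p ^+ k) <= (k * a).+1)%N.
Proof.
move=> p_le; elim: k => [|k IHk]; first by rewrite expr0 msize1.
by rewrite exprS mulSn; apply: msizeM_le_add.
Qed.

Lemma msize_prod_le_sum n (I : finType) (P : I -> {mpoly K[n]}) (a : I -> nat) :
  (forall i, msize (P i) <= (a i).+1)%N ->
  (msize (\prod_i P i) <= (\sum_i a i).+1)%N.
Proof.
move=> P_le; apply: (big_ind2 (fun p k => msize p <= k.+1)%N) => //.
  by rewrite msize1.
by move=> ? ? ? ?; apply: msizeM_le_add.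
Qed.

(** The n + 1 polynomials phi and G in n variables are algebraically dependent:
    the D^(n+1) products of powers with exponents < D have degree < c D for a
    constant c, so that they lie in the span of the (c D)^n monomials with
    exponents < c D, and (c D)^n < D^(n+1) as soon as c^n < D.  In the relation,
    seen as a polynomial in G with coefficients in K[phi], the lowest power of G
    can be cancelled, and the constant term N(phi) of what remains is a multiple
    of G. *)
Lemma hypersurface_image n (phi : 'I_n -> {mpoly K[n]}) (G : {mpoly K[n]}) :
  G != 0 ->
  exists2 N : {mpoly K[n]}, N != 0 &
    forall w, G.@[w] = 0 -> N.@[fun i => (phi i).@[w]] = 0.
Proof.
move=> G_neq0.
pose delta := (maxn (msize G) (\max_i msize (phi i))).+1.
have G_le : (msize G <= delta.+1)%N by do 2!apply: leqW; apply: leq_maxl.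
have phi_le i : (msize (phi i) <= delta.+1)%N.
  by do 2!apply: leqW; rewrite leq_max (leq_bigmax i) orbT.
pose c := (n.+1 * delta)%N; pose D := (c ^ n).+1; pose M := (c * D)%N.
pose A : finType := ({ffun 'I_n -> 'I_D} * 'I_D)%type.
pose B : finType := {ffun 'I_n -> 'I_M}.
pose mon (a : A) := \prod_i phi i ^+ a.1 i.
have term_le a : (msize (mon a * G ^+ a.2) <= M)%N.
  have -> : M = (n * (c ^ n * delta) + c ^ n * delta + c.-1).+1.
    by rewrite /M /D /c; lia.
  apply: leq_trans (_ : (n * (c ^ n * delta) + c ^ n * delta).+1 <= _)%N.
    apply: msizeM_le_add.
      rewrite -[n in (n * _)%N]card_ord -sum_nat_const.
      apply: msize_prod_le_sum => i.
      apply: leq_trans (msizeX_le_mul _ (phi_le i)) _.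
      by rewrite ltnS leq_mul2r -ltnS ltn_ord orbT.
    apply: leq_trans (msizeX_le_mul _ G_le) _.
    by rewrite ltnS leq_mul2r -ltnS ltn_ord orbT.
  by rewrite ltnS leq_addr.
have ltBA : (#|B| < #|A|)%N.
  rewrite card_prod !card_ffun !card_ord /M expnMn mulnC.
  by rewrite ltn_pmul2l ?expn_gt0.
have [h [a1 h_a1] hE] := nontrivial_relation
  (fun (a : A) (b : B) => (mon a * G ^+ a.2)@_[multinom val (b i) | i < n]) ltBA.
have rel0 : \sum_a h a *: (mon a * G ^+ a.2) = 0.
  apply/mpolyP => m; rewrite mcoeff0 raddf_sum /=.
  under eq_bigr do rewrite mcoeffZ.
  have [/forallP lt_m|] := boolP [forall i, (m i < M)%N].
    rewrite -[RHS](hE [ffun i => Ordinal (lt_m i)]).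
    apply: eq_bigr => a _; congr (_ * _@__).
    by apply/mnmP => i; rewrite mnmE ffunE.
  case/forallPn=> i; rewrite -leqNgt => le_mi.
  rewrite big1 // => a _; rewrite [_@_m]memN_msupp_eq0 ?mulr0 //.
  apply: msize_mdeg_ge; apply: leq_trans (term_le a) (leq_trans le_mi _).
  by rewrite mdegE (bigD1 i) //= leq_addr.
(* k is the lowest power of G that occurs in the relation. *)
have exk : exists k, [exists a, (h a != 0) && (a.2 == k :> nat)].
  by exists a1.2; apply/existsP; exists a1; rewrite h_a1 eqxx.
case: (ex_minnP exk) => k /existsP[a0 /andP[h_a0 /eqP a0_k]] k_min {exk}.
exists (\sum_(a : A | a.2 == k :> nat) h a *: 'X_[[multinom val (a.1 i) | i < n]]).
  apply: contra_neq h_a0 => /(congr1 (mcoeff [multinom val (a0.1 i) | i < n])).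
  rewrite mcoeff0 raddf_sum /= (bigD1 a0) ?a0_k //= mcoeffZ mcoeffX eqxx mulr1.
  rewrite big1 ?addr0 // => a /andP[/eqP a_k a_neq].
  rewrite mcoeffZ mcoeffX; case: eqP => [/mnmP eq_a|]; last by rewrite mulr0.
  case/eqP: a_neq; case: a a_k eq_a => a a' /= a_k eq_a.
  rewrite [a0]surjective_pairing; congr pair; last first.
    by apply: val_inj; rewrite /= a_k a0_k.
  by apply/ffunP => i; apply: val_inj; have := eq_a i; rewrite !mnmE.
move=> w Gw0.
(* No term of the relation has an exponent of G below k, by minimality. *)
have : G ^+ k * \sum_(a : A | (k <= a.2)%N) h a *: (mon a * G ^+ (a.2 - k)) = 0.
  rewrite -[RHS]rel0 mulr_sumr [in RHS](bigID (fun a : A => k <= a.2)%N) /=.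
  rewrite [X in _ = _ + X]big1 => [|a]; last first.
    rewrite -ltnNge => lt_ak; suff /eqP-> : h a == 0 by rewrite scale0r.
    apply: contraTT lt_ak => ha; rewrite -leqNgt; apply: k_min.
    by apply/existsP; exists a; rewrite ha eqxx.
  rewrite addr0; apply: eq_bigr => a le_ka.
  by rewrite -scalerAr mulrCA -exprD subnKC.
move/eqP; rewrite mulf_eq0 expf_eq0 (negbTE G_neq0) andbF /= => /eqP.
move/(congr1 (meval w)); rewrite meval0 raddf_sum /= => rel_k.
rewrite raddf_sum /= -[RHS]rel_k [RHS](bigID (fun a : A => a.2 == k :> nat)) /=.
rewrite [X in _ = _ + X]big1 => [|a /andP[le_ka neq_ak]]; last first.
  rewrite mevalZ mevalM rmorphXn /= Gw0 expr0n subn_eq0.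
  by rewrite leqNgt ltn_neqAle eq_sym neq_ak le_ka /= !mulr0.
rewrite addr0; apply: eq_big => [a|a /eqP a_k].
  by case: eqP => [->|]; rewrite ?leqnn ?andbF.
rewrite !mevalZ mevalX mevalM a_k subnn expr0 meval1 mulr1; congr (_ * _).
rewrite /mon rmorph_prod; apply: eq_bigr => i _.
by rewrite rmorphXn mnmE.
Qed.

End PolynomialMaps.

(** * Open sets in projective space *)

Lemma meval_scale_homog (K : fieldType) n k
    (F : {mpoly K[n]}) (t : K) (v : 'I_n -> K) :
  F \is k.-homog -> F.@[fun i => t * v i] = t ^+ k * F.@[v].
Proof.
move=> /dhomogP F_homog; rewrite !mevalE mulr_sumr !big_seq.
apply: eq_bigr => m m_F; rewrite mulrCA; congr (_ * _).
have -> : k = (\sum_i m i)%N by rewrite -mdegE; have := F_homog m m_F.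
rewrite expr_sum -big_split /=.
by apply: eq_bigr => i _; rewrite exprMn.
Qed.

(** For v on the line x, the value N (t v) is a polynomial in t whose coefficients
    are the values at v of the homogeneous components of N.  So N vanishes on all
    of x exactly when these components do, and they define the closed
    complement. *)
Lemma zariski_open_nonvanishing (K : closedFieldType) (V : vectType K)
    (N : {mpoly K[\dim {:V}]}) :
  zariski_open (fun x : projective V =>
    exists2 v : V, v \in val x &
      N.@[fun i => coord (vbasis {:V}) i v] != 0).
Proof.
exists (fun F => exists k, F = pihomog mdeg k N); split.
  by move=> _ [k ->]; exists k; apply: pihomogP.
move=> x; split=> [N_x0 _ [k ->] v v_x|N_x0 [v v_x]]; last first.
  rewrite (pihomog_partitionE (leqnn (msize N))) raddf_sum /= big1 ?eqxx //.
  by move=> k _; apply: N_x0 => //; exists k.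
pose b := maxn (msize N) k.+1.
pose N_ j := (pihomog mdeg j N).@[fun i => coord (vbasis {:V}) i v].
have : \poly_(j < b) N_ j = 0.
  apply/eqP/negPn/negP => /closed_nonrootP[t]; case/negP; apply/rootP.
  rewrite horner_poly; apply/eqP/negPn/negP => N_tv; case: N_x0.
  exists (t *: v); first exact: memvZ.
  rewrite (pihomog_partitionE (leq_maxl (msize N) k.+1)) raddf_sum /=.
  apply: contra_neq N_tv => N_tv; rewrite -[RHS]N_tv; apply: eq_bigr => j _.
  rewrite mulrC -meval_scale_homog ?pihomogP //.
  by apply: meval_eq => i; rewrite linearZ.
by move=> /polyP/(_ k); rewrite coef_poly coef0 leq_max ltnSn orbT.
Qed.

(** * Constructions from linear forms *)

Section Forms.
Variable A : comRingType.
Implicit Types (u a b c : A * A * A) (v : 'I_3 -> A).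

(** The triple u stands for the linear form with these coefficients; dot u v is its
    value at v. *)
Definition dot u v : A := u.1.1 * v 0 + u.1.2 * v 1 + u.2 * v 2.

Definition det3 a b c : A :=
  a.1.1 * (b.1.2 * c.2 - b.2 * c.1.2) - a.1.2 * (b.1.1 * c.2 - b.2 * c.1.1)
    + a.2 * (b.1.1 * c.1.2 - b.1.2 * c.1.1).

(** Cramer's rule: the coordinates of u with respect to a, b, c, up to the
    factor det3 a b c. *)
Lemma cramer3 a b c u v :
  det3 a b c * dot u v =
  det3 u b c * dot a v + det3 a u c * dot b v + det3 a b u * dot c v.
Proof. rewrite /det3 /dot; ring. Qed.

Lemma det3_rot a b c : det3 a b c = det3 b c a.
Proof. rewrite /det3; ring. Qed.

End Forms.

Section Lines.
Variable K : fieldType.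
Implicit Types (u a b c : K * K * K) (v : 'rV[K]_3).

Lemma det3_dot_eq0 a b c v : det3 a b c != 0 ->
  dot a (v 0) = 0 -> dot b (v 0) = 0 -> dot c (v 0) = 0 -> v = 0.
Proof.
move=> abc av bv cv; have uv0 u : dot u (v 0) = 0.
  apply: (mulfI abc); rewrite cramer3 av bv cv; ring.
apply/rowP => i; rewrite mxE.
have := (uv0 (1, 0, 0), uv0 (0, 1, 0), uv0 (0, 0, 1)).
rewrite /dot /= !(mul0r, mul1r, add0r, addr0) => -[[v0 v1] v2].
by case: i => [[|[|[|//]]] lt_i]; [rewrite -v0|rewrite -v1|rewrite -v2];
  congr (v _ _); apply: val_inj.
Qed.

Definition line_space u : {vspace 'rV[K]_3} :=
  lker (linfun (mulmxr (\col_i [:: u.1.1; u.1.2; u.2]`_i))).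

Lemma mem_line_space u v : (v \in line_space u) = (dot u (v 0) == 0).
Proof.
rewrite memv_ker lfunE /=; set w := v *m _.
have wE : w 0 0 = dot u (v 0).
  rewrite mxE !big_ord_recl big_ord0 !mxE /= addr0 addrA /dot.
  rewrite !(mulrC (v 0 _)).
  by congr (_ * v _ _ + _ * v _ _ + _ * v _ _); apply: val_inj.
rewrite -wE; apply/eqP/eqP => [->|w0]; first by rewrite mxE.
by apply/matrixP => i j; rewrite !ord1 w0 mxE.
Qed.

Lemma dim_cap_line_space (U : {vspace 'rV[K]_3}) u :
  (\dim U <= (\dim (U :&: line_space u)).+1)%N.
Proof.
rewrite -(limg_ker_dim (linfun (mulmxr (\col_i [:: u.1.1; u.1.2; u.2]`_i))) U).
by rewrite -[X in (_ <= X)%N]addn1 leq_add2l (leq_trans (dimvS (subvf _))) // dimvf.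
Qed.

Lemma cap_line_spaces a b c : det3 a b c != 0 ->
  (line_space a :&: line_space b :&: line_space c = 0)%VS.
Proof.
move=> abc; apply/eqP; rewrite -subv0; apply/subvP => v.
rewrite !memv_cap !mem_line_space memv0 => /andP[/andP[/eqP av /eqP bv] /eqP cv].
by apply/eqP; apply: det3_dot_eq0 abc av bv cv.
Qed.

(** Each linear form cuts the dimension by at most one, and three independent ones
    bring it from 3 down to 0, so each cuts it by exactly one. *)
Lemma dim_line_spaces a b c : det3 a b c != 0 ->
  \dim (line_space a) = 2%N /\ \dim (line_space a :&: line_space b) = 1%N.
Proof.
move=> abc.
have le2 := dim_cap_line_space (line_space a) b.
have le1 := dim_cap_line_space (line_space a :&: line_space b)%VS c.
have le3 := dim_cap_line_space {:'rV[K]_3}%VS a.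
rewrite cap_line_spaces // dimv0 capfv dimvf in le1 le3.
have d3 : dim 'rV[K]_3 = 3%N by []. rewrite d3 in le3.
by split; lia.
Qed.
End Lines.

(** At a point of l i and L j the right side of the identity vanishes, so F or m
    does; m is the line of the diagonal points and avoids the others.  If two
    of the points P i j coincided, then two lines of one colour would be
    concurrent with a line of the other colour. *)
Lemma constructible_of_identity (K : fieldType) d (X : curve K d.+1)
    (F : dhomog 3 K d.+1) (l L : 'I_d.+2 -> K * K * K) (m : K * K * K) :
  F != 0 -> F \in val X ->
  (forall v : 'I_3 -> K, (F : {mpoly K[3]}).@[v] * dot m v =
     \prod_i dot (l i) v - \prod_i dot (L i) v) ->
  (forall i j j', j != j' -> det3 (l i) (L j) (L j') != 0) ->
  (forall i i' j, i != i' -> det3 (l i) (l i') (L j) != 0) ->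
  (forall i j, (det3 m (l i) (L j) == 0) = (i == j)) ->
  constructible X.
Proof.
move=> F_neq0 F_X FE blue_gen red_gen m_diag.
(* Any second blue line serves as the third independent form for l i, L j. *)
pose other (j : 'I_d.+2) : 'I_d.+2 := if j == ord0 then ord_max else ord0.
have otherP j : j != other j.
  by rewrite /other; have [->|] := eqVneq j ord0.
have genP i j := blue_gen i j _ (otherP j).
have dim_l i : \dim (line_space (l i)) == 2%N.
  by rewrite (dim_line_spaces (genP i ord0)).1.
have dim_L j : \dim (line_space (L j)) == 2%N.
  have := genP ord0 j; rewrite det3_rot => /dim_line_spaces[-> _].
  exact: eqxx.
have dim_P i j : \dim (line_space (l i) :&: line_space (L j)) == 1%N.
  by rewrite (dim_line_spaces (genP i j)).2.
have dim_m : \dim (line_space m) == 2%N.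
  have : det3 m (l ord0) (L ord_max) != 0 by rewrite m_diag.
  by move=> /dim_line_spaces[-> _].
pose subspace k W (dim_W : \dim W == k) :=
  exist (fun W : {vspace 'rV[K]_3} => \dim W == k) W dim_W.
exists (fun i => subspace _ _ (dim_l i)), (fun j => subspace _ _ (dim_L j)).
exists (fun i j => subspace _ _ (dim_P i j)); split=> //.
- move=> i j i' j' /(congr1 val) /= eq_P.
  have [v [v_neq0 [li Lj]] [li' Lj']] : exists2 v : 'rV[K]_3, v != 0 /\
      dot (l i) (v 0) = 0 /\ dot (L j) (v 0) = 0 &
      dot (l i') (v 0) = 0 /\ dot (L j') (v 0) = 0.
    pose P := (line_space (l i) :&: line_space (L j))%VS.
    have P_neq0 : P != 0%VS by rewrite -dimv_eq0 (eqP (dim_P i j)).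
    exists (vpick P).
      split; first by rewrite vpick0.
      have := memv_pick P; rewrite memv_cap !mem_line_space.
      by case/andP=> /eqP ? /eqP ?.
    have := memv_pick P; rewrite {2}/P eq_P memv_cap !mem_line_space.
    by case/andP=> /eqP ? /eqP ?.
  suff : (i == i') && (j == j') by case/andP=> /eqP ? /eqP ?.
  apply: contraNT v_neq0; rewrite negb_and => /orP[neq_i|neq_j]; apply/eqP.
    exact: det3_dot_eq0 (red_gen _ _ j neq_i) li li' Lj.
  exact: det3_dot_eq0 (blue_gen i _ _ neq_j) li Lj Lj'.
- exists (subspace _ _ dim_m) => i; apply/subvP => v /=.
  rewrite memv_cap !mem_line_space => /andP[/eqP li_v /eqP Li_v].
  have := cramer3 (l i) (L i) (L (other i)) m (v 0).
  rewrite li_v Li_v -[det3 _ _ m]det3_rot (eqP (_ : det3 m (l i) (L i) == 0)).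
    rewrite mul0r !mulr0 !addr0 => /eqP.
    by rewrite mulf_eq0 (negbTE (genP i i)).
  by rewrite m_diag eqxx.
move=> i j neq_ij f v f_X /=.
rewrite memv_cap !mem_line_space => /andP[/eqP li_v /eqP Lj_v].
have [->|v_neq0] := eqVneq v 0.
  have := meval_scale_homog 0 (fun=> 0) (dhomog_is_dhomog f).
  rewrite expr0n /= !mul0r => f0; rewrite -[RHS]f0.
  by apply: meval_eq => k; rewrite mxE.
have X_F : val X = <[F]>%VS.
  apply/eqP; rewrite eq_sym eqEdim -memvE F_X dim_vline F_neq0.
  by rewrite (eqP (valP X)).
move: f_X; rewrite X_F => /vlineP[k ->].
have -> : (k *: F : dhomog 3 K d.+1) = k *: (F : {mpoly K[3]}) :> {mpoly K[3]}.
  by [].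
rewrite mevalZ.
apply/eqP; rewrite mulf_eq0; apply/orP; right.
have m_v : dot m (v 0) != 0.
  apply: contra_neq v_neq0 => m_v.
  by apply: det3_dot_eq0 m_v li_v Lj_v; rewrite m_diag.
rewrite -(mulIr_eq0 _ (mulIf m_v)) FE (bigD1 i) //= li_v.
by rewrite [X in _ - X](bigD1 j) //= Lj_v !mul0r subrr.
Qed.

(** * The explicit configuration *)

(** The vector w lists the parameters e, a1, a2, b1, b2, c1, c2, d1, d2, d3. *)
Local Notation "w `_[ k ]" := (w (@Ordinal 10 k isT)) (at level 8, k at level 2).

Section Configuration.
Variable A : comRingType.
Implicit Type w : 'I_10 -> A.

(** The linear form m with r0 r1 r2 - a b c = x y m: its coefficients are those of
    x^2 y, x y^2 and x y z on the left side. *)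
Definition pappus_line w : A * A * A :=
  let: (a1, a2) := (w`_[1], w`_[2]) in
  let: (b1, b2) := (w`_[3], w`_[4]) in
  let: (c1, c2) := (w`_[5], w`_[6]) in
  (a1 * a2 * c1 + a1 * b1 * b2 + b1 * c1 * c2
     - (a1 * b1 * c2 + a1 * b2 * c1 + a2 * b1 * c1),
   a1 * a2 * b2 + a2 * c1 * c2 + b1 * b2 * c2
     - (a1 * b2 * c2 + a2 * b1 * c2 + a2 * b2 * c1),
   a1 * a2 + b1 * b2 + c1 * c2 - (a1 * c2 + b1 * a2 + c1 * b2)).

(** The first three lines r0, r1, r2 join the points of b and c, of c and a, of
    a and b on x = 0 and y = 0, respectively: the line with coefficients
    (p, q, 1) meets y = 0 where p x + z = 0 and x = 0 where q y + z = 0.  The last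
    one is d. *)
Definition red w (i : 'I_4) : A * A * A :=
  nth (w`_[7], w`_[8], w`_[9])
    [:: (w`_[5], w`_[4], 1); (w`_[1], w`_[6], 1); (w`_[3], w`_[2], 1)] i.

(** The forms a, b, c and d - e m, in the order that pairs them with the red
    lines. *)
Definition blue w (i : 'I_4) : A * A * A :=
  nth (w`_[7] - w`_[0] * (pappus_line w).1.1,
       w`_[8] - w`_[0] * (pappus_line w).1.2,
       w`_[9] - w`_[0] * (pappus_line w).2)
    [:: (w`_[1], w`_[2], 1); (w`_[3], w`_[4], 1); (w`_[5], w`_[6], 1)] i.

(** The coefficients of x y d + e a b c, in the order of the monomials listed in
    cubic_exponents. *)
Definition cubic_coef w (i : 'I_10) : A :=
  let: (e, d1, d2, d3) := (w`_[0], w`_[7], w`_[8], w`_[9]) in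
  let: (a1, a2) := (w`_[1], w`_[2]) in
  let: (b1, b2) := (w`_[3], w`_[4]) in
  let: (c1, c2) := (w`_[5], w`_[6]) in
  [:: e;
      e * (a1 + b1 + c1); e * (a2 + b2 + c2);
      e * (a1 * b1 + a1 * c1 + b1 * c1); e * (a2 * b2 + a2 * c2 + b2 * c2);
      e * (a1 * b1 * c1); e * (a2 * b2 * c2);
      d3 + e * (a1 * b2 + a1 * c2 + b1 * a2 + b1 * c2 + c1 * a2 + c1 * b2);
      d1 + e * (a1 * b1 * c2 + a1 * b2 * c1 + a2 * b1 * c1);
      d2 + e * (a1 * b2 * c2 + a2 * b1 * c2 + a2 * b2 * c1)]`_i.

Definition nondegeneracy w : A :=
  (\prod_i \prod_j \prod_(k | j != k) det3 (red w i) (blue w j) (blue w k))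
  * (\prod_i \prod_j \prod_(k | i != k) det3 (red w i) (red w k) (blue w j))
  * (\prod_i \prod_(j | i != j) det3 (pappus_line w) (red w i) (blue w j)).

(** For the first three pairs this is the theorem of Pappus; in the last pair, the
    blue form is a combination of m and the red one. *)
Lemma pappus_diag w i : det3 (pappus_line w) (red w i) (blue w i) = 0.
Proof.
by case: i => [[|[|[|[|//]]]] lt_i]; rewrite /det3 /red /blue /pappus_line /=; ring.
Qed.

Definition cubic_exponents : seq (seq nat) :=
  [:: [:: 0; 0; 3]; [:: 1; 0; 2]; [:: 0; 1; 2]; [:: 2; 0; 1]; [:: 0; 2; 1];
      [:: 3; 0; 0]; [:: 0; 3; 0]; [:: 1; 1; 1]; [:: 2; 1; 0]; [:: 1; 2; 0]]%N.

Definition cubic_monomial (i : 'I_10) : 'X_{1..3} :=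
  [multinom nth 0%N (nth [::] cubic_exponents i) j | j < 3].

Lemma cubic_identity w (v : 'I_3 -> A) :
  (\sum_i cubic_coef w i * \prod_j v j ^+ cubic_monomial i j)
    * dot (pappus_line w) v =
  \prod_i dot (red w i) v - \prod_i dot (blue w i) v.
Proof.
have -> : \sum_i cubic_coef w i * \prod_j v j ^+ cubic_monomial i j =
  \sum_i cubic_coef w i * (v 0 ^+ nth 0%N (nth [::] cubic_exponents i) 0
    * v 1 ^+ nth 0%N (nth [::] cubic_exponents i) 1
    * v 2 ^+ nth 0%N (nth [::] cubic_exponents i) 2).
  apply: eq_bigr => i _; congr (_ * _).
  rewrite !big_ord_recl big_ord0 !mnmE mulr1 mulrA.
  by congr (_ * v _ ^+ _ * v _ ^+ _); apply: val_inj.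
rewrite !big_ord_recl !big_ord0.
rewrite /cubic_coef /dot /red /blue /pappus_line /cubic_exponents /=; ring.
Qed.

End Configuration.

(** Ring morphisms commute with all the constructions.  Along an evaluation of
    polynomials this shows that they depend polynomially on w, and along
    int -> K it reduces the numerical example to integers. *)
Section BaseChange.
Variables (A B : comRingType) (f : {rmorphism A -> B}).
Variables (w : 'I_10 -> A) (w' : 'I_10 -> B).
Hypothesis w'E : forall i, w' i = f (w i).

Let f3 (t : A * A * A) : B * B * B := (f t.1.1, f t.1.2, f t.2).

Let rmorphE := (w'E, rmorphD, rmorphN, rmorphM, rmorph1).

Lemma det3_rmorph a b c : det3 (f3 a) (f3 b) (f3 c) = f (det3 a b c).
Proof. by rewrite /det3 /f3 /= !rmorphE. Qed.

Lemma pappus_line_rmorph : pappus_line w' = f3 (pappus_line w).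
Proof. by rewrite /pappus_line /f3 /= !rmorphE. Qed.

Lemma red_rmorph i : red w' i = f3 (red w i).
Proof.
by case: i => [[|[|[|[|//]]]] lt_i]; rewrite /red /f3 /= ?rmorphE.
Qed.

Lemma blue_rmorph i : blue w' i = f3 (blue w i).
Proof.
rewrite /blue pappus_line_rmorph.
by case: i => [[|[|[|[|//]]]] lt_i]; rewrite /f3 /= ?rmorphE.
Qed.

Lemma nondegeneracy_rmorph : nondegeneracy w' = f (nondegeneracy w).
Proof.
rewrite /nondegeneracy !rmorphM !rmorph_prod pappus_line_rmorph.
congr (_ * _ * _); apply: eq_bigr => i _; rewrite rmorph_prod.
- apply: eq_bigr => j _; rewrite rmorph_prod; apply: eq_bigr => k _.
  by rewrite red_rmorph !blue_rmorph det3_rmorph.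
- apply: eq_bigr => j _; rewrite rmorph_prod; apply: eq_bigr => k _.
  by rewrite !red_rmorph blue_rmorph det3_rmorph.
- by apply: eq_bigr => j _; rewrite red_rmorph blue_rmorph det3_rmorph.
Qed.

Lemma cubic_coef_rmorph i : cubic_coef w' i = f (cubic_coef w i).
Proof.
rewrite /cubic_coef.
by case: i => [[|[|[|[|[|[|[|[|[|[|//]]]]]]]]]] lt_i]; rewrite /= ?rmorphE.
Qed.

End BaseChange.

Lemma nondegeneracy_neq0P (A : idomainType) (w : 'I_10 -> A) :
  reflect
    [/\ forall i j k, j != k -> det3 (red w i) (blue w j) (blue w k) != 0,
         forall i k j, i != k -> det3 (red w i) (red w k) (blue w j) != 0
       & forall i j, i != j -> det3 (pappus_line w) (red w i) (blue w j) != 0]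
    (nondegeneracy w != 0).
Proof.
rewrite /nondegeneracy !mulf_eq0 !negb_or -andbA.
apply: (iffP and3P) => -[gen_blue gen_red gen_pappus]; split.
- move=> i j k; have /prodf_neq0/(_ i isT)/prodf_neq0/(_ j isT) := gen_blue.
  by move/prodf_neq0; apply.
- move=> i k j; have /prodf_neq0/(_ i isT)/prodf_neq0/(_ j isT) := gen_red.
  by move/prodf_neq0; apply.
- by move=> i; have /prodf_neq0/(_ i isT)/prodf_neq0 := gen_pappus.
- apply/prodf_neq0 => i _; apply/prodf_neq0 => j _; apply/prodf_neq0 => k.
  exact: gen_blue.
- apply/prodf_neq0 => i _; apply/prodf_neq0 => j _; apply/prodf_neq0 => k.
  by move=> ?; apply: gen_red.
- by apply/prodf_neq0 => i _; apply/prodf_neq0 => j; apply: gen_pappus.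
Qed.

(** Small parameters for which none of the determinants vanishes. *)
Definition sample (i : 'I_10) : int := [:: 1; 1; 2; 0; 1; 2; 0; 1; 2; 0]`_i.

Lemma sample_nondegenerate : nondegeneracy sample != 0.
Proof.
apply/nondegeneracy_neq0P; split.
- by do 3![case=> [[|[|[|[|//]]]] ?]] => //= _; vm_compute.
- by do 3![case=> [[|[|[|[|//]]]] ?]] => //= _; vm_compute.
- by do 2![case=> [[|[|[|[|//]]]] ?]] => //= _; vm_compute.
Qed.

Lemma nondegeneracy_poly_neq0 (K : numFieldType) :
  nondegeneracy (fun i => 'X_i : {mpoly K[10]}) != 0.
Proof.
pose p : 'I_10 -> K := intr \o sample.
apply/eqP => /(congr1 (meval p)); rewrite meval0.
rewrite -(nondegeneracy_rmorph (f := meval p) (w' := p)); last first.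
  by move=> i; rewrite /= mevalXU.
rewrite (nondegeneracy_rmorph (f := intmul 1) (w := sample)) // => /eqP.
by rewrite intr_eq0; apply/negP/sample_nondegenerate.
Qed.

(** * Parametrization of cubics *)

Lemma cubic_monomial_inj : injective cubic_monomial.
Proof.
move=> i j /mnmP eq_ij; move: (eq_ij 0) (eq_ij 1) (eq_ij 2); rewrite !mnmE.
by case: i {eq_ij} => [[|[|[|[|[|[|[|[|[|[|//]]]]]]]]]] ?];
  case: j => [[|[|[|[|[|[|[|[|[|[|//]]]]]]]]]] ?] //= _ _ _; apply: val_inj.
Qed.

Lemma mdeg_cubic_monomial i : mdeg (cubic_monomial i) = 3%N.
Proof.
rewrite mdegE !big_ord_recl big_ord0 !mnmE.
by case: i => [[|[|[|[|[|[|[|[|[|[|//]]]]]]]]]] ?].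
Qed.

Lemma cubic_monomialP (m : 'X_{1..3}) :
  mdeg m = 3%N -> exists i, m = cubic_monomial i.
Proof.
rewrite mdegE !big_ord_recl big_ord0 /= addn0.
set p := m ord0; set q := m (lift _ _); set r := m (lift _ _) => sum3.
have mE : m = [multinom nth 0%N [:: p; q; r] j | j < 3].
  apply/mnmP => -[[|[|[|//]]] lt_j]; rewrite mnmE /p /q /r /=;
    by congr (m _); apply: val_inj.
have r_le : r = (3 - (p + q))%N by move: sum3; rewrite addnA => <-; rewrite addKn.
have /(nthP [::])[i lt_i iE] : [:: p; q; r] \in cubic_exponents.
  have : (p + q <= 3)%N by rewrite -sum3 addnA leq_addr.
  by rewrite r_le; case: (p) (q) => [|[|[|[|?]]]] [|[|[|[|?]]]].
by exists (Ordinal lt_i); rewrite mE /cubic_monomial iE.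
Qed.

Lemma cubic_expansion (K : fieldType) (F : {mpoly K[3]}) (v : 'I_3 -> K) :
  F \is 3.-homog ->
  F.@[v] = \sum_i F@_(cubic_monomial i) * \prod_j v j ^+ cubic_monomial i j.
Proof.
move=> F_homog.
have {1}-> : F = \sum_i F@_(cubic_monomial i) *: 'X_[cubic_monomial i].
  apply/mpolyP => m; rewrite raddf_sum /=; under eq_bigr do rewrite mcoeffZ mcoeffX.
  have [deg_m|deg_m] := eqVneq (mdeg m) 3; last first.
    rewrite (dhomog_nemf_coeff F_homog deg_m) big1 // => i _.
    case: eqP => [i_m|]; last by rewrite mulr0.
    by rewrite i_m (dhomog_nemf_coeff F_homog deg_m) mul0r.
  have [i ->] := cubic_monomialP deg_m.
  rewrite (bigD1 i) //= eqxx mulr1 big1 ?addr0 // => j neq_ji.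
  by rewrite (inj_eq cubic_monomial_inj) (negbTE neq_ji) mulr0.
by rewrite raddf_sum; apply: eq_bigr => i _; rewrite /= mevalZ mevalX.
Qed.

(** Take a root a of T^3 - s1 T^2 + s2 T - s3, then a root b of the quotient
    T^2 - (s1 - a) T + (s2 - a (s1 - a)) by T - a. *)
Lemma split_cubic (K : closedFieldType) (s1 s2 s3 : K) :
  exists a b c, [/\ s1 = a + b + c, s2 = a * b + a * c + b * c & s3 = a * b * c].
Proof.
have [a aE] := @solve_monicpoly K 3 (nth 0 [:: s3; - s2; s1]) isT.
have [b bE] := @solve_monicpoly K 2 (nth 0 [:: - (s2 - a * (s1 - a)); s1 - a]) isT.
rewrite !big_ord_recl !big_ord0 /= in aE bE.
exists a, b, (s1 - a - b); split; first by ring.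
- ring: bE.
- ring: bE aE.
Qed.

(** The coefficients at monomials free of y give the elementary symmetric
    functions of a1, b1, c1, those free of x give the ones of a2, b2, c2; the
    other three coefficients are corrected by the choice of d. *)
Lemma cubic_coef_onto (K : closedFieldType) (u : 'I_10 -> K) :
  u ord0 != 0 -> exists w, cubic_coef w =1 u.
Proof.
move=> e_neq0; set e := u ord0 in e_neq0.
have [a1 [b1 [c1 [s1 s2 s3]]]] := split_cubic (u`_[1] / e) (u`_[3] / e) (u`_[5] / e).
have [a2 [b2 [c2 [t1 t2 t3]]]] := split_cubic (u`_[2] / e) (u`_[4] / e) (u`_[6] / e).
exists (fun i => [:: e; a1; a2; b1; b2; c1; c2;
  u`_[8] - e * (a1 * b1 * c2 + a1 * b2 * c1 + a2 * b1 * c1);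
  u`_[9] - e * (a1 * b2 * c2 + a2 * b1 * c2 + a2 * b2 * c1);
  u`_[7] - e * (a1 * b2 + a1 * c2 + b1 * a2 + b1 * c2 + c1 * a2 + c1 * b2)]`_i).
move=> i; rewrite /cubic_coef /=.
rewrite -s1 -s2 -s3 -t1 -t2 -t3 !subrK !(mulrC e) !divfK //.
by case: i => [[|[|[|[|[|[|[|[|[|[|//]]]]]]]]]] lt_i] /=; congr u; apply: val_inj.
Qed.

Theorem theorem11 (R : realType) : construction_dense (complex R) 3.
Proof.
set K : numClosedFieldType := complex R.
pose phi := cubic_coef (fun i => 'X_i : {mpoly K[10]}).
have [N N_neq0 N_phi] := hypersurface_image phi (nondegeneracy_poly_neq0 K).
have phiE w i : (phi i).@[w] = cubic_coef w i.
  by symmetry; apply: cubic_coef_rmorph => j; rewrite /= mevalXU.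
have degE w : (nondegeneracy (fun i => 'X_i : {mpoly K[10]})).@[w] = nondegeneracy w.
  by symmetry; apply: nondegeneracy_rmorph => j; rewrite /= mevalXU.
pose V : vectType K := dhomog 3 K 3.
pose coefs (F : dhomog 3 K 3) i := (F : {mpoly K[3]})@_(cubic_monomial i).
pose coef_form i : {mpoly K[\dim {:V}]} :=
  \sum_(k < \dim {:V}) coefs (vbasis {:V})`_k i *: 'X_k.
(* N' is N times the coefficient at z^3, in the coordinates of S_3 that
   define its topology. *)
pose N' := (N * 'X_ord0) \mPo [tuple coef_form i | i < 10].
have N'E (F : V) : N'.@[fun k => coord (vbasis {:V}) k F] =
                   N.@[coefs F] * coefs F ord0.
  rewrite comp_mpoly_meval -mevalXU -mevalM; apply: meval_eq => i.
  rewrite tnth_mktuple raddf_sum /= /coefs {2}(coord_vbasis (memvf F)).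
  rewrite !raddf_sum; apply: eq_bigr => k _ /=.
  by rewrite mevalZ mevalXU mcoeffZ mulrC.
exists (fun X : curve K 3 => exists2 F : V, F \in val X &
  N'.@[fun k => coord (vbasis {:V}) k F] != 0); split.
- exact: zariski_open_nonvanishing.
- have NX_neq0 : N * 'X_ord0 != 0 :> {mpoly K[10]}.
    by rewrite mulf_neq0 // -msize_poly_eq0 msizeX mdeg1.
  have [u u_neq0] := exists_meval_neq0 NX_neq0.
  pose p : {mpoly K[3]} := \sum_i u i *: 'X_[cubic_monomial i].
  have p_homog : p \is 3.-homog.
    rewrite rpred_sum // => i _; rewrite rpredZ // dhomogX.
    by apply/eqP/mdeg_cubic_monomial.
  pose F : V := DHomog p_homog.
  have coefs_F i : coefs F i = u i.
    rewrite /coefs raddf_sum /= (bigD1 i) //= mcoeffZ mcoeffX eqxx mulr1.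
    rewrite big1 ?addr0 // => j neq_ji.
    by rewrite mcoeffZ mcoeffX (inj_eq cubic_monomial_inj) (negbTE neq_ji) mulr0.
  have N'_F : N'.@[fun k => coord (vbasis {:V}) k F] != 0.
    rewrite N'E coefs_F -(meval_eq N (fun i => esym (coefs_F i))).
    by rewrite -mevalXU -mevalM.
  have F_neq0 : F != 0.
    apply: contra_neq N'_F => F0.
    by rewrite N'E F0 [coefs _ _]mcoeff0 mulr0.
  have dim_F : \dim <[F]> == 1%N by rewrite dim_vline F_neq0.
  exists (exist (fun W : {vspace V} => \dim W == 1%N) <[F]>%VS dim_F).
  by exists F; first exact: memv_line.
move=> X [F F_X]; rewrite N'E mulf_eq0 negb_or => /andP[NF_neq0 eF_neq0].
have [w wE] := cubic_coef_onto eF_neq0.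
have /nondegeneracy_neq0P[blue_gen red_gen pappus_gen] : nondegeneracy w != 0.
  rewrite -degE; apply: contra_neq NF_neq0 => /N_phi <-.
  by apply: meval_eq => i; rewrite phiE wE.
apply: (constructible_of_identity (F := F) (l := red w) (L := blue w)
          (m := pappus_line w)) => //.
- by apply: contra_neq eF_neq0 => ->; rewrite /coefs mcoeff0.
- move=> v; rewrite -cubic_identity cubic_expansion ?dhomog_is_dhomog //.
  by congr (_ * _); apply: eq_bigr => i _; rewrite wE.
- move=> i j; have [<-|/pappus_gen/negbTE//] := eqVneq i j.
  by rewrite pappus_diag eqxx.
Qed.
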